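(* Let $\mathbf B$ be an $n\times q$ random matrix with i.i.d. $\mathcal N(0,1)$ entries, $\mathbf C$ a deterministic $q\times p$ matrix, and $\mathbf A=\mathbf B\mathbf C$. Let $\mathcal K\subset\mathbb R^p$ and $\varepsilon\ge0$. For $\mathbf x^\star\in\mathcal K$, suppose we observe $\mathbf y=\mathbf A\mathbf x^\star+\boldsymbol\nu$ with $\frac1n\|\boldsymbol\nu\|_1\le\varepsilon$, and choose $\widehat{\mathbf x}$ to be any vector satisfying $\widehat{\mathbf x}\in\mathcal K$ and $\frac1n\|\mathbf A\widehat{\mathbf x}-\mathbf y\|_1\le\varepsilon$. Then $$\mathbb E\sup_{\mathbf x^\star\in\mathcal K}\left\{(\widehat{\mathbf x}-\mathbf x^\star)^T\mathbf C^T\mathbf C(\widehat{\mathbf x}-\mathbf x^\star)\right\}^{1/2}\le\sqrt{2\pi}\left(\frac{\mathbb E\sup_{\mathbf u\in\mathcal K-\mathcal K}|\langle\mathbf C^T\mathbf g,\mathbf u\rangle|}{\sqrt n}+\varepsilon\right),$$ where $\mathbf g\sim\mathcal N(0,\mathbf I_q)$ and $\mathcal K-\mathcal K=\{\mathbf u-\mathbf v:\mathbf u,\mathbf v\in\mathcal K\}$.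
   Context: No assumption is made on the error $\boldsymbol\nu$ other than $\frac1n\|\boldsymbol\nu\|_1\le\varepsilon$; $\widehat{\mathbf x}$ may be any vector meeting the stated feasibility conditions for the given $\mathbf y$. *)

(* Defs.v *)
From HB Require Import structures.
From mathcomp Require Import all_boot all_order all_algebra.
From mathcomp Require Import all_classical all_reals all_analysis.
Set Implicit Arguments. Unset Strict Implicit. Unset Printing Implicit Defensive.
Import Order.TTheory GRing.Theory Num.Theory.
Local Open Scope classical_set_scope.
Local Open Scope ring_scope.

(* [std_gaussian_matrix P X]: the entries of the random m x k matrix X are
   measurable, each has the standard normal law N(0,1), and the family of all
   m*k entries is mutually independent (product rule for every choice of
   measurable sets, one per entry; choosing [setT] recovers every subfamily). *)
Definition std_gaussian_matrix {R : realType} (d : measure_display)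
  (T : measurableType d) (P : probability T R) (m k : nat)
  (X : T -> 'M[R]_(m, k)) : Prop :=
  [/\ (forall i j, measurable_fun setT (fun w => X w i j)),
      (forall i j (E : set R), measurable E ->
         P [set w | E (X w i j)] = normal_prob 0 1 E) &
      (forall E : 'I_m -> 'I_k -> set R, (forall i j, measurable (E i j)) ->
         P [set w | forall i j, E i j (X w i j)] =
         (\prod_(i < m) \prod_(j < k) P [set w | E i j (X w i j)])%E)].

Definition l1norm {R : realType} (m : nat) (v : 'cV[R]_m) : R :=
  \sum_(i < m) `|v i 0|.

Definition mdiff {R : realType} (p : nat) (K : set 'cV[R]_p) : set 'cV[R]_p :=
  [set u | exists a b, [/\ K a, K b & u = a - b]].

(* Main.v *)
(* Write c = sqrt (2 / pi) for the mean of |N(0,1)| and V = C (K - K).  A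
   feasible pair gives v = C (xh - x) in V with |B v|_1 <= 2 n eps, so that
     n c |v| <= 2 n eps + sup_(v in V) sum_i (c |v| - |<b_i, v>|).
   It remains to bound the mean of the last supremum by that of
   sup_(v in V) 2 <sum_i b_i, v>, because sum_i b_i is distributed as
   sqrt n g and 2 / c = sqrt (2 pi).  The rows are exchanged one at a time: for
   every offset h, symmetrization and contraction give
     E sup_v (h v + c |v| - |<b_i, v>|) <= E sup_v (h v + 2 <b_i, v>).
   Both sides of the theorem may involve non-measurable suprema, so V is first
   replaced by a countable dense subset containing 0. *)
Require Import Defs.
From HB Require Import structures.
From mathcomp Require Import all_boot all_order all_algebra.
From mathcomp Require Import all_classical all_reals all_analysis.
From mathcomp Require Import measurable_realfun ring lra.
Import Order.TTheory GRing.Theory Num.Theory.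
Import numFieldNormedType.Exports.
Local Open Scope classical_set_scope.
Local Open Scope ring_scope.

(** * Powers of a probability measure *)

(** Exchanging the rows singly avoids Rademacher signs: while one row is treated, everything else is
    frozen in the offset h, and the only symmetry needed is g -> -g. The replaced rows merge by
    themselves, since sqrt n g + b has the law of sqrt (n + 1) g for an independent copy b. The
    suprema may have infinite mean, so no integrability is assumed. The zero vector in the countable
    family makes every supremum nonnegative, and Tonelli and additivity for nonnegative functions
    then suffice. The matrix and the vector of the statement live on unrelated probability spaces.
    Both are transported to canonical products of Gaussian laws, where rows and coordinates split
    off by induction. Countable, hence measurable, suprema are inserted between the two sides: one
    bounds the left integrand from above, the other bounds the right integrand from below, and both
    comparisons are pointwise. *)

Section product_probability.
Context {R : realType} {d1 d2 : measure_display}.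
Context {T1 : measurableType d1} {T2 : measurableType d2}.
Context (P : probability T1 R) (Q : probability T2 R).
Local Open Scope ereal_scope.

Definition prod_prob : set (T1 * T2) -> \bar R := P \x Q.

HB.instance Definition _ := Measure.on prod_prob.

Let prod_probT : prod_prob [set: T1 * T2] = 1%E.
Proof.
transitivity (P setT * Q setT); last by rewrite !probability_setT mule1.
by rewrite -product_measure1E// setXTT.
Qed.

HB.instance Definition _ := Measure_isProbability.Build _ _ _
  prod_prob prod_probT.

End product_probability.

Section power_probability.
Context {R : realType} {d : measure_display} {T : measurableType d}.
Local Open Scope ereal_scope.

Definition tcons {n} (z : T * n.-tuple T) : n.+1.-tuple T :=
  [tuple of z.1 :: z.2].

Lemma measurable_tcons n : measurable_fun setT (@tcons n).
Proof. exact: measurable_cons. Qed.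

HB.instance Definition _ n :=
  isMeasurableFun.Build _ _ _ _ (@tcons n) (measurable_tcons n).

(** Pushing the product forward along [tcons] lets integrals unfold one coordinate at a time, which
    is what the inductions on rows and on coordinates use. *)
Fixpoint power_prob (P : probability T R) (n : nat) :
    probability (n.-tuple T) R :=
  match n with
  | 0 => \d_([tuple] : 0.-tuple T)
  | m.+1 => distribution (prod_prob P (power_prob P m)) (@tcons m)
  end.

Lemma integral_power_prob0 (P : probability T R) (f : 0.-tuple T -> \bar R) :
  measurable_fun [set: 0.-tuple T] f ->
  \int[power_prob P 0]_t f t = f [tuple].
Proof. by move=> mf; rewrite /= integral_dirac// diracT mul1e. Qed.

Lemma integral_power_probS (P : probability T R) n
    (f : n.+1.-tuple T -> \bar R) :
  measurable_fun [set: _.-tuple T] f -> (forall t, 0 <= f t) ->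
  \int[power_prob P n.+1]_t f t =
  \int[P]_x \int[power_prob P n]_t f (tcons (x, t)).
Proof.
move=> mf f0 /=; rewrite ge0_integral_distribution//.
by rewrite fubini_tonelli1//=; apply: measurableT_comp => //.
Qed.

Definition box {n} (E : 'I_n -> set T) : set (n.-tuple T) :=
  [set t | forall i, E i (tnth t i)].

Lemma measurable_box n (E : 'I_n -> set T) :
  (forall i, measurable (E i)) -> measurable (box E).
Proof.
move=> mE; have -> : box E =
    \bigcap_(i in [set: 'I_n]) ((@tnth n T ^~ i) @^-1` (E i)).
  by apply/seteqP; split=> t /= h i => [_|]; exact: h.
apply: fin_bigcap_measurable => // i _.
by rewrite -[X in measurable X]setTI; exact: measurable_tnth.
Qed.

Lemma power_prob_box (P : probability T R) n (E : 'I_n -> set T) :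
  (forall i, measurable (E i)) ->
  power_prob P n (box E) = \prod_(i < n) P (E i).
Proof.
elim: n => [|n IH] in E *; move=> mE.
  by rewrite big_ord0 /= diracE mem_set//= => -[].
rewrite big_ord_recl/= -IH// -product_measure1E//; last exact: measurable_box.
rewrite /distribution /pushforward /=; congr (_ _).
apply/seteqP; split=> [[x t]/= h|[x t]/= [hx ht] i].
  split=> [|i /=]; first exact: (h ord0).
  by have := h (lift ord0 i); rewrite tnthS.
case: (unliftP ord0 i) => [j|] -> //.
by rewrite tnthS; exact: ht.
Qed.

End power_probability.

(** * Uniqueness of laws on tuples, tested on boxes *)

Section tuple_uniqueness.
Context {d : measure_display} {T : measurableType d}.
Variable G : set (set T).
Hypotheses (mG : measurable = <<s G>>) (setIG : setI_closed G) (GT : G setT).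

Definition boxes n : set (set (n.-tuple T)) :=
  [set A | exists2 E, (forall i, G (E i)) & A = box E].

Let Gm A : G A -> measurable A.
Proof. by move=> GA; rewrite mG; exact: sub_sigma_algebra. Qed.

Lemma measurable_boxes n : @measurable _ (n.-tuple T) = <<s boxes n >>.
Proof.
apply/seteqP; split; last first.
  apply: smallest_sub; first exact: sigma_algebra_measurable.
  by move=> _ [E GE ->]; apply: measurable_box => i; exact/Gm/GE.
apply: smallest_sub; first exact: smallest_sigma_algebra.
move=> A; rewrite -bigcup_seq/= => -[i _ [B mB <-]]; rewrite setTI.
have : <<s G >> B by rewrite -mG.
(* The sets whose cylinder over coordinate [i] is generated by boxes form a sigma-algebra, so it
   suffices that they include [G]. *)
move=> /(_ [set C | <<s boxes n >> ((@tnth n T ^~ i) @^-1` C)]); apply.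
split=> [|/=]; last first.
  move=> C GC; apply: sub_sigma_algebra.
  exists (fun j => if j == i then C else setT) => [j|]; first by case: ifP.
  apply/seteqP; split=> t /= h => [j|]; first by case: eqP => // ->.
  by have := h i; rewrite eqxx.
split=> /=.
- by rewrite preimage_set0; exact: sigma_algebra0.
- by move=> C hC; rewrite setTD preimage_setC; exact: sigma_algebraC.
- by move=> F hF; rewrite preimage_bigcup; exact: sigma_algebra_bigcup.
Qed.

Lemma boxesT n : boxes n setT.
Proof. by exists (fun=> setT) => //; apply/seteqP; split. Qed.

Lemma setI_boxes n : setI_closed (boxes n).
Proof.
move=> _ _ [E GE ->] [F GF ->]; exists (fun i => E i `&` F i) => [i|].
  exact: setIG.
apply/seteqP; split=> t /=; first by move=> [hE hF] i; split.
by move=> h; split=> i; have [] := h i.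
Qed.

(** [G] is left general because the rows of a matrix are themselves tuples: with [G] the boxes of a
    row, the test sets constrain the entries separately, as the product rule of
    [std_gaussian_matrix] requires. *)
Lemma tuple_law_unique {R : realType} n (P Q : probability (n.-tuple T) R) :
  (forall E, (forall i, G (E i)) -> P (box E) = Q (box E)) ->
  forall A, measurable A -> P A = Q A.
Proof.
move=> PQ A mA; apply: (measure_unique (boxes n) (fun=> setT)) => //.
- exact: measurable_boxes.
- exact: setI_boxes.
- by move=> _; exact: boxesT.
- by rewrite bigcup_const//; exists 0%N.
- by move=> _ [E GE ->]; exact: PQ.
- by move=> _; rewrite (le_lt_trans (probability_le1 _ _)) ?ltry.
Qed.

End tuple_uniqueness.

Section standard_gaussian.
Context {R : realType}.

(* Transports measures from [measurableTypeR R], where [normal_prob] lives, to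
   [R] with its default display, which is the one used for random variables. *)
Definition borel_id (x : measurableTypeR R) : R := x.

Lemma measurable_borel_id : measurable_fun setT borel_id.
Proof. by move=> _ A mA; rewrite setTI. Qed.

HB.instance Definition _ :=
  isMeasurableFun.Build _ _ _ _ borel_id measurable_borel_id.

Definition gauss : probability R R :=
  distribution (normal_prob 0 1) borel_id.

End standard_gaussian.

Section gaussian_laws.
Context {R : realType} {d : measure_display} {T : measurableType d}.
Context (P : probability T R).
Local Open Scope ereal_scope.

Definition mxrows {m k : nat} (A : 'M[R]_(m, k)) : m.-tuple (k.-tuple R) :=
  [tuple [tuple A i j | j < k] | i < m].

Lemma measurable_mxrows m k (X : T -> 'M[R]_(m, k)) :
  (forall i j, measurable_fun setT (fun w => X w i j)) ->
  measurable_fun setT (fun w => mxrows (X w)).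
Proof.
move=> mX; apply/measurable_fun_tnthP => i; apply/measurable_fun_tnthP => j.
rewrite (_ : _ \o _ = fun w => X w i j)//.
by apply/funext => w; rewrite /= !tnth_mktuple.
Qed.

Lemma integral_gaussian_matrix m k (X : T -> 'M[R]_(m, k))
    (f : m.-tuple (k.-tuple R) -> \bar R) :
  std_gaussian_matrix P X ->
  measurable_fun [set: m.-tuple (k.-tuple R)] f -> (forall t, 0 <= f t) ->
  \int[P]_w f (mxrows (X w)) =
  \int[power_prob (power_prob gauss k) m]_t f t.
Proof.
move=> [mX lawX indX] mf f0.
pose Y := fun w => mxrows (X w).
pose mY := isMeasurableFun.Build _ _ _ _ Y (measurable_mxrows _ _ _ mX).
pose Z : {mfun T >-> m.-tuple (k.-tuple R)} := HB.pack Y mY.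
rewrite -(ge0_integral_distribution Z)//.
apply: eq_measure_integral => A mA _.
pose G := boxes (@measurable _ R) k.
have mG : @measurable _ R = <<s @measurable _ R >>.
  by rewrite sigma_algebra_id//; exact: sigma_algebra_measurable.
apply: (@tuple_law_unique _ _ G) mA.
- exact: measurable_boxes.
- by apply: setI_boxes => B C; exact: measurableI.
- exact: boxesT.
move=> E EG.
have /choice[F EF] i : exists F : 'I_k -> set R,
    (forall j, measurable (F j)) /\ E i = box F.
  by have [F ? ?] := EG i; exists F.
rewrite power_prob_box; last first.
  by move=> i; have [mF ->] := EF i; exact: measurable_box.
have mF i j : measurable (F i j) by have [] := EF i.
transitivity (P [set w | forall i j, F i j (X w i j)]).
  congr (P _); apply/seteqP; split=> w /= h i.
    have := h i; have [_ ->] := EF i; rewrite tnth_mktuple => {}h j.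
    by have := h j; rewrite tnth_mktuple.
  have [_ ->] := EF i; rewrite tnth_mktuple => j.
  by rewrite tnth_mktuple; exact: h.
rewrite indX//; apply: eq_bigr => i _.
have [_ ->] := EF i; rewrite power_prob_box//.
by apply: eq_bigr => j _; rewrite (lawX _ _ _ (mF i j)).
Qed.

End gaussian_laws.

(** * Stability of Gaussian measures *)

Section gaussian_integrals.
Context {R : realType}.
Local Open Scope ereal_scope.
Local Notation mu := (@lebesgue_measure R).
Local Notation L := (measurableTypeR R).

(** The change of variables speaks of the Radon-Nikodym derivative; it equals the density almost
    everywhere because both have the same integral over every measurable set. *)
Lemma integral_normal_prob (f : L -> \bar R) :
  measurable_fun [set: L] f -> (forall x, 0 <= f x) ->
  \int[normal_prob (0 : R) 1]_x f x =
  \int[mu]_x (f x * (normal_pdf 0 1 x)%:E).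
Proof.
move=> mf f0.
have dom := @normal_prob_dominates R 0 1.
rewrite -(Radon_Nikodym_SigmaFinite.change_of_variables dom)//.
apply: ae_eq_integral => //.
- apply: emeasurable_funM => //.
  apply: measurable_int.
  exact: Radon_Nikodym_SigmaFinite.f_integrable.
- apply: emeasurable_funM => //; apply/measurable_EFinP.
  exact: measurable_normal_pdf.
apply: ae_eqe_mul2l; apply: integral_ae_eq => //.
- exact: Radon_Nikodym_SigmaFinite.f_integrable.
- by apply/measurable_EFinP; exact: measurable_normal_pdf.
- by move=> E _ mE; rewrite -Radon_Nikodym_SigmaFinite.f_integral.
Qed.

Lemma integral_gaussE (f : R -> \bar R) :
  measurable_fun [set: R] f -> (forall x, 0 <= f x) ->
  \int[gauss]_x f x = \int[mu]_x (f x * (normal_pdf 0 1 x)%:E).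
Proof.
move=> mf f0; by rewrite ge0_integral_distribution// integral_normal_prob.
Qed.

Lemma measurable_affine (b c : R) :
  measurable_fun [set: L] (fun x : L => (b * x + c)%R : L).
Proof. by apply: measurable_funD => //; apply: measurable_funM. Qed.

(** The image of Lebesgue measure under x -> b x + c, multiplied by b, agrees with Lebesgue measure
    on half-open intervals, hence everywhere. *)
Lemma ge0_integral_affine (b c : R) (f : L -> \bar R) : (0 < b)%R ->
  measurable_fun [set: L] f -> (forall x, 0 <= f x) ->
  \int[mu]_x f x = b%:E * \int[mu]_x f (b * x + c)%R.
Proof.
move=> b0 mf f0.
pose phi := fun x : L => (b * x + c)%R : L.
have <- : \int[pushforward mu phi]_x f x = \int[mu]_x f (b * x + c)%R.
  by rewrite (ge0_integral_pushforward (measurable_affine b c)).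
have b_num : (NngNum (ltW b0))%:num = b by [].
rewrite -{1}b_num -ge0_integral_mscale//; first exact: measurable_affine.
move=> mphi; apply: eq_measure_integral => A mA _.
apply: lebesgue_measure_unique => // _ [[x y]] _ <-.
rewrite /= /mscale/= /pushforward.
rewrite (_ : phi @^-1` _ =
    `]((x - c) / b)%R, ((y - c) / b)%R]%classic); last first.
  apply/seteqP; split=> z /=; rewrite !in_itv/= ltr_pdivrMr// ler_pdivlMr//;
  by rewrite ltrBlDr lerBrDr mulrC.
rewrite !lebesgue_measure_itv/= !lte_fin ltr_pM2r ?invr_gt0// ltrD2r.
case: ifPn => xy; last by rewrite mule0.
rewrite -!EFinB -EFinM -mulrBl mulrCA divff ?gt_eqF// mulr1.
by congr EFin; ring.
Qed.

(* Completing the square: the joint density of (x, z = a x + b y) is the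
   density of N(0, s^2) at z times that of x given z. *)
Lemma normal_pdf_conv (a b x z : R) : (0 < b)%R ->
  let s := Num.sqrt (a ^+ 2 + b ^+ 2) in
  (normal_pdf 0 1 x * (normal_pdf 0 1 ((z - a * x) / b) / b) =
  (normal_pdf 0 1 (z / s) / s) * normal_pdf (a * z / s ^+ 2) (b / s) x)%R.
Proof.
move=> b0 s.
have ab0 : (0 < a ^+ 2 + b ^+ 2)%R by rewrite ltr_wpDl ?sqr_ge0// exprn_gt0.
have s0 : (0 < s)%R by rewrite sqrtr_gt0.
have s2 : (s ^+ 2 = a ^+ 2 + b ^+ 2)%R by rewrite sqr_sqrtr// ltW.
rewrite !normal_pdfE ?oner_neq0//; last by rewrite gt_eqF// divr_gt0.
have -> : normal_peak (b / s) = (s / b * normal_peak 1)%R.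
  rewrite /normal_peak expr1n mul1r -mulrnAr sqrtrM ?sqr_ge0//.
  by rewrite sqrtr_sqr ger0_norm ?divr_ge0 ?ltW// invfM invf_div.
rewrite /normal_fun.
set p := normal_peak 1.
transitivity (p ^+ 2 / b * (expR (- (x - 0) ^+ 2 / (1 ^+ 2 *+ 2)) *
   expR (- ((z - a * x) / b - 0) ^+ 2 / (1 ^+ 2 *+ 2))))%R; first by ring.
transitivity (p ^+ 2 / b * (expR (- (z / s - 0) ^+ 2 / (1 ^+ 2 *+ 2)) *
   expR (- (x - a * z / s ^+ 2) ^+ 2 / ((b / s) ^+ 2 *+ 2))))%R; last first.
  by field; rewrite !gt_eqF.
congr (_ * _)%R; rewrite -!expRD; congr expR.
rewrite !subr0 !expr1n !expr_div_n !s2.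
by field; rewrite !gt_eqF//.
Qed.

End gaussian_integrals.

Lemma integral_prob_cst {R : realType} {d} {T : measurableType d}
  (P : probability T R) (c : \bar R) : (\int[P]_x c = c)%E.
Proof.
by rewrite integral_cst//= probability_setT mule1.
Qed.

Section gauss_stability.
Context {R : realType}.
Local Open Scope ereal_scope.
Local Notation mu := (@lebesgue_measure R).
Local Notation L := (measurableTypeR R).
Implicit Types f : R -> \bar R.

Let mpdf (m s : R) : measurable_fun [set: L] (fun x => (normal_pdf m s x)%:E).
Proof. by apply/measurable_EFinP; exact: measurable_normal_pdf. Qed.

Lemma integral_gaussN f :
  measurable_fun [set: R] f -> (forall x, 0 <= f x) ->
  \int[gauss]_x f (- x)%R = \int[gauss]_x f x.
Proof.
move=> mf f0.
have mfN : measurable_fun [set: R] (fun x : R => f (- x)%R).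
  exact: measurableT_comp.
rewrite !integral_gaussE//.
transitivity (\int[pushforward mu (-%R : _ -> L)]_x
    (f x * (normal_pdf 0 1 x)%:E)).
  rewrite ge0_integral_pushforward//=.
  - apply: eq_integral => x _; congr (_ * _%:E).
    by rewrite !normal_pdfE ?oner_neq0// /normal_fun !subr0 sqrrN.
  - exact: emeasurable_funM.
  - by move=> x _; rewrite mule_ge0// lee_fin normal_pdf_ge0.
by apply: eq_measure_integral => //= A mA _; exact: lebesgue_measureN.
Qed.

(** Substitute z = a x + b y in the inner integral and exchange the order. By [normal_pdf_conv] the
    inner integral over x is then that of a normal density, so it equals 1, and rescaling z by s
    leaves the standard density. *)
Let gauss_stable_gt0 (a b : R) f : (0 < b)%R ->
  measurable_fun [set: R] f -> (forall x, 0 <= f x) ->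
  \int[gauss]_x \int[gauss]_y f (a * x + b * y)%R =
  \int[gauss]_x f (Num.sqrt (a ^+ 2 + b ^+ 2) * x)%R.
Proof.
move=> b0 mf f0.
pose s := Num.sqrt (a ^+ 2 + b ^+ 2).
have ab0 : (0 < a ^+ 2 + b ^+ 2)%R by rewrite ltr_wpDl ?sqr_ge0// exprn_gt0.
have s0 : (0 < s)%R by rewrite sqrtr_gt0.
have p0 m t x : 0 <= (normal_pdf m t x : R)%:E.
  by rewrite lee_fin normal_pdf_ge0.
have maff c e : measurable_fun [set: R] (fun x : R => (c * x + e)%R).
  by apply: measurable_funD => //; exact: measurable_funM.
have mfL : measurable_fun [set: L] f.
  exact: measurableT_comp mf measurable_borel_id.
have mker (T : measurableType _) (u v : T -> L) :
    measurable_fun setT u -> measurable_fun setT v ->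
    measurable_fun setT (fun t =>
      (normal_pdf 0 1 ((v t - a * u t) / b) / b : R)%:E).
  move=> mu' mv; apply/measurable_EFinP; apply: measurable_funM => //.
  apply: (measurableT_comp (measurable_normal_pdf 0 1)).
  apply: measurable_funM => //; apply: measurable_funB => //.
  exact: measurable_funM.
have ker0 x z : 0 <= (normal_pdf 0 1 ((z - a * x) / b) / b : R)%:E.
  by rewrite lee_fin divr_ge0 ?normal_pdf_ge0// ltW.
have inner x : \int[gauss]_y f (a * x + b * y)%R =
    \int[mu]_z (f z * (normal_pdf 0 1 ((z - a * x) / b) / b)%:E).
  rewrite integral_gaussE//; last first.
    apply: measurableT_comp => //.
    under eq_fun do rewrite addrC.
    exact: maff.
  have mg : measurable_fun [set: L]
      (fun z => f z * (normal_pdf 0 1 ((z - a * x) / b) / b)%:E).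
    by apply: emeasurable_funM => //; exact: mker.
  rewrite [RHS](ge0_integral_affine b (a * x)%R)//; last first.
    by move=> z; rewrite mule_ge0.
  rewrite -ge0_integralZl//; last 3 first.
  - exact: (measurableT_comp mg (measurable_affine b (a * x)%R)).
  - by move=> y _; rewrite mule_ge0.
  - by rewrite lee_fin ltW.
  apply: eq_integral => y _.
  rewrite muleCA -EFinM addrC addrK (mulrC b y) mulfK ?gt_eqF//.
  by rewrite mulrCA divff ?mulr1// gt_eqF.
rewrite integral_gaussE//; last 2 first.
- apply: (measurable_fun_fubini_tonelli_F
    (fun z : R * R => f (a * z.1 + b * z.2)%R)) => //.
  apply: measurableT_comp => //.
  by apply: measurable_funD; apply: measurable_funM => //.
- by move=> x; exact: integral_ge0.
pose h (z : L * L) : \bar R :=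
  f z.2 * (normal_pdf 0 1 ((z.2 - a * z.1) / b) / b)%:E *
  (normal_pdf 0 1 z.1)%:E.
transitivity (\int[mu]_x \int[mu]_z h (x, z)).
  apply: eq_integral => x _; rewrite inner -ge0_integralZr//.
  - by apply: emeasurable_funM => //; exact: mker.
  - by move=> y _; rewrite mule_ge0.
rewrite (fubini_tonelli h); last 2 first.
- apply: emeasurable_funM; last first.
    exact: (measurableT_comp (mpdf 0 1) measurable_fst).
  apply: emeasurable_funM; first exact: (measurableT_comp mfL measurable_snd).
  exact: mker measurable_fst measurable_snd.
- by move=> z; rewrite !mule_ge0.
transitivity (\int[mu]_z (f z * (normal_pdf 0 1 (z / s) / s)%:E)).
  apply: eq_integral => z _.
  under eq_integral => x _.
    rewrite /h/= -muleA -EFinM mulrC normal_pdf_conv// -/s EFinM muleA; over.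
  rewrite ge0_integralZl//; first by rewrite integral_normal_pdf mule1.
  by rewrite mule_ge0// lee_fin divr_ge0 ?normal_pdf_ge0// ltW.
have mg : measurable_fun [set: L]
    (fun z => f z * (normal_pdf 0 1 (z / s) / s)%:E).
  apply: emeasurable_funM => //; apply/measurable_EFinP.
  apply: measurable_funM => //.
  apply: (measurableT_comp (measurable_normal_pdf 0 1)).
  exact: measurable_funM.
rewrite (ge0_integral_affine s 0)//; last first.
  by move=> z; rewrite mule_ge0// lee_fin divr_ge0 ?normal_pdf_ge0// ltW.
rewrite -ge0_integralZl//; last 3 first.
- exact: (measurableT_comp mg (measurable_affine s 0)).
- by move=> y _; rewrite mule_ge0// lee_fin divr_ge0 ?normal_pdf_ge0// ltW.
- by rewrite lee_fin ltW.
rewrite integral_gaussE//; last first.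
  by apply: measurableT_comp => //; exact: measurable_funM.
apply: eq_integral => x _.
rewrite addr0 muleCA -EFinM (mulrC s x) mulfK ?gt_eqF//.
by rewrite mulrCA divff ?mulr1// gt_eqF.
Qed.

Lemma gauss_stable (a b : R) f :
  measurable_fun [set: R] f -> (forall x, 0 <= f x) ->
  \int[gauss]_x \int[gauss]_y f (a * x + b * y)%R =
  \int[gauss]_x f (Num.sqrt (a ^+ 2 + b ^+ 2) * x)%R.
Proof.
move=> mf f0.
have mM (c : R) : measurable_fun [set: R] (fun x : R => f (c * x)%R).
  by apply: measurableT_comp => //; exact: measurable_funM.
(* The sign of b is absorbed by the symmetry of [gauss]; for b = 0 the square root is |a| and the
   same symmetry applies to a. *)
have [b0|b0|->] := ltgtP b 0%R.
- rewrite -(sqrrN b) -gauss_stable_gt0 ?oppr_gt0//.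
  apply: eq_integral => x _.
  rewrite -[RHS]integral_gaussN//.
    by apply: eq_integral => y _; rewrite mulrNN.
  by apply: measurableT_comp => //; exact: measurable_funD.
- exact: gauss_stable_gt0.
under eq_integral => x _.
  under eq_integral do rewrite mul0r addr0.
  rewrite integral_prob_cst; over.
rewrite expr0n/= addr0 sqrtr_sqr.
have [a0|a0] := leP 0%R a; first by rewrite ger0_norm.
rewrite ltr0_norm// -integral_gaussN//.
by apply: eq_integral => x _; rewrite mulrN mulNr.
Qed.

Lemma integral_gauss_norm :
  \int[gauss]_x `|x|%:E = (2 * (Num.sqrt (pi *+ 2))^-1 : R)%:E.
Proof.
rewrite integral_gaussE//; last first.
  by apply/measurable_EFinP; exact: normr_measurable.
pose p (x : R) : R := (normal_peak 1 * expR (- x ^+ 2 / 2))%R.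
have pE x : normal_pdf 0 1 x = p x.
  by rewrite normal_pdfE ?oner_neq0// /p /normal_fun subr0 expr1n.
have cp : continuous p.
  have -> : p = normal_pdf 0 1 by apply/funext => x; rewrite pE.
  exact: continuous_normal_pdf (oner_neq0 _).
have p_ge0 x : (0 <= p x)%R by rewrite -pE normal_pdf_ge0.
under eq_integral => x _ do rewrite -EFinM pE.
have cf : continuous (fun x : R => `|x| * p x)%R.
  by move=> x; apply: cvgM; [exact: norm_continuous|exact: cp].
rewrite ge0_symfun_integralT//; last 2 first.
- by move=> x; rewrite mulr_ge0.
- by move=> x; rewrite /= normrN /p sqrrN.
rewrite -set_itvcy EFinM; congr (_ * _).
transitivity (\int[mu]_(x in `[0%R, +oo[) (x * p x)%:E).
  apply: eq_integral => x; rewrite inE/= in_itv/= andbT => x0.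
  by rewrite ger0_norm.
(* By evenness only the half line matters, and there -p is a primitive of x p(x); the half integral
   is thus p(0), the peak of the density. *)
have dp (x : R) : is_derive x 1%R (fun x => - p x)%R (x * p x)%R.
  rewrite /p; apply: is_derive_eq.
  rewrite !scaler0 add0r; set e := expR _; rewrite /GRing.scale/=.
  by field.
rewrite (@ge0_continuous_FTC2y _ _ (fun x => - p x)%R 0%R 0%R).
- rewrite /p expr0n/= oppr0 mul0r expR0 mulr1 /normal_peak expr1n mul1r.
  by rewrite -EFinB sub0r opprK.
- by move=> x x0; rewrite mulr_ge0.
- by apply: continuous_subspaceT => x; apply: cvgM; [exact: cvg_id|exact: cp].
- rewrite -oppr0; apply: cvgN; rewrite -(mulr0 (normal_peak 1)).
  apply: cvgM; first exact: cvg_cst.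
  rewrite (_ : (fun x : R => expR _) = fun x => gauss_fun (x / Num.sqrt 2))%R.
    apply: (cvg_comp _ _ _ (@cvg_gauss_fun R)).
    by apply: gt0_cvgMly; rewrite ?invr_gt0 ?sqrtr_gt0//; exact: cvg_id.
  by apply/funext => x; rewrite /gauss_fun expr_div_n sqr_sqrtr// mulNr.
- by move=> x _; have /(_ x)[] := dp.
- by apply: cvg_at_right_filter; apply: cvgN; exact: cp.
by move=> x _; rewrite derive1E; have /(_ x)[_ ->] := dp.
Qed.

End gauss_stability.

Section probability_fubini.
Context {R : realType} {d1 d2 : measure_display}.
Context {T1 : measurableType d1} {T2 : measurableType d2}.
Context (P : probability T1 R) (Q : probability T2 R).
Local Open Scope ereal_scope.
Variable F : T1 -> T2 -> \bar R.
Hypothesis mF : measurable_fun setT (fun z : T1 * T2 => F z.1 z.2).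
Hypothesis F0 : forall x y, 0 <= F x y.

Lemma measurable_fun_integral : measurable_fun setT (fun x => \int[Q]_y F x y).
Proof.
exact: (measurable_fun_fubini_tonelli_F (fun z : T1 * T2 => F z.1 z.2)).
Qed.

Lemma integral_swap :
  \int[P]_x \int[Q]_y F x y = \int[Q]_y \int[P]_x F x y.
Proof. by rewrite (fubini_tonelli (fun z : T1 * T2 => F z.1 z.2)). Qed.

End probability_fubini.

(** * Gaussian vectors and their linear functionals *)

Section gaussian_vectors.
Context {R : realType}.
Local Open Scope ereal_scope.

(** With [t = 0] this doubles as the multiplication of a tuple by the scalar [s]. *)
Definition tlin {q} (s t : R) (g b : q.-tuple R) : q.-tuple R :=
  [tuple (s * tnth g i + t * tnth b i)%R | i < q].

Definition tdot {q} (v : 'I_q -> R) (g : q.-tuple R) : R :=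
  (\sum_(i < q) v i * tnth g i)%R.

Definition vnorm {q} (v : 'I_q -> R) : R := Num.sqrt (\sum_(i < q) v i ^+ 2).

Lemma measurable_tlin {d} {T : measurableType d} {q} (s t : R)
    (g b : T -> q.-tuple R) :
  measurable_fun setT g -> measurable_fun setT b ->
  measurable_fun setT (fun w => tlin s t (g w) (b w)).
Proof.
move=> /measurable_fun_tnthP mg /measurable_fun_tnthP mb.
apply/measurable_fun_tnthP => i.
rewrite (_ : _ \o _ = fun w => (s * tnth (g w) i + t * tnth (b w) i)%R).
  by apply: measurable_funD; apply: measurable_funM => //;
    [exact: mg|exact: mb].
by apply/funext => w /=; rewrite tnth_mktuple.
Qed.

Lemma measurable_tdot {d} {T : measurableType d} {q} (v : 'I_q -> R)
    (g : T -> q.-tuple R) :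
  measurable_fun setT g -> measurable_fun setT (fun w => tdot v (g w)).
Proof.
move=> /measurable_fun_tnthP mg.
apply: measurable_sum => i; apply: measurable_funM => //; exact: mg.
Qed.

Lemma tlin_cons q (s t x y : R) (g b : q.-tuple R) :
  tlin s t (tcons (x, g)) (tcons (y, b)) =
  tcons ((s * x + t * y)%R, tlin s t g b).
Proof.
apply/eq_from_tnth => i; rewrite tnth_mktuple.
by case: (unliftP ord0 i) => [j|] ->; rewrite /tcons/= ?tnthS ?tnth_mktuple.
Qed.

Lemma tdot_cons q (v : 'I_q.+1 -> R) (x : R) (g : q.-tuple R) :
  tdot v (tcons (x, g)) =
  (v ord0 * x + tdot (fun i => v (lift ord0 i)) g)%R.
Proof.
rewrite /tdot big_ord_recl; congr (_ + _)%R.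
by apply: eq_bigr => i _; rewrite /tcons/= tnthS.
Qed.

Lemma tdot_tlin q (v : 'I_q -> R) (s t : R) (g b : q.-tuple R) :
  tdot v (tlin s t g b) = (s * tdot v g + t * tdot v b)%R.
Proof.
rewrite /tdot !mulr_sumr -big_split/=; apply: eq_bigr => i _.
by rewrite tnth_mktuple; ring.
Qed.

(** Induction on coordinates: [gauss_stable] merges the two heads, and the induction hypothesis
    merges the two tails with the heads frozen. *)
Lemma gauss_vector_stable q (s t : R) (f : q.-tuple R -> \bar R) :
  measurable_fun [set: q.-tuple R] f -> (forall g, 0 <= f g) ->
  \int[power_prob gauss q]_g \int[power_prob gauss q]_b f (tlin s t g b) =
  \int[power_prob gauss q]_g f (tlin (Num.sqrt (s ^+ 2 + t ^+ 2)) 0 g g).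
Proof.
elim: q => [|q IH] in f * => mf f0.
  have e g : f g = f [tuple] by rewrite (tuple0 g).
  transitivity (f [tuple]).
    rewrite -[RHS](integral_prob_cst (power_prob gauss 0)).
    apply: eq_integral => g _.
    rewrite -[RHS](integral_prob_cst (power_prob gauss 0)).
    by apply: eq_integral => b _; rewrite e.
  rewrite -[LHS](integral_prob_cst (power_prob gauss 0)).
  by apply: eq_integral => g _; rewrite [in RHS]e.
have mftl d (T : measurableType d) (g b : T -> q.+1.-tuple R) a c :
    measurable_fun setT g -> measurable_fun setT b ->
    measurable_fun setT (fun w => f (tlin a c (g w) (b w))).
  move=> mg mb; exact: measurableT_comp (measurable_tlin _ _ _ _ mg mb).
have mcons d (T : measurableType d) (x : T -> R) (g : T -> q.-tuple R) :
    measurable_fun setT x -> measurable_fun setT g ->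
    measurable_fun setT (fun w => tcons (x w, g w)).
  by move=> mx mg; exact: measurable_cons.
rewrite integral_power_probS; last 2 first.
- apply: (measurable_fun_integral _ (fun g b => f (tlin s t g b))) => //.
  exact: mftl.
- by move=> g; exact: integral_ge0.
rewrite [RHS]integral_power_probS//; last exact: mftl.
pose r := Num.sqrt (s ^+ 2 + t ^+ 2).
pose phi z := \int[power_prob gauss q]_g f (tcons (z, tlin r 0 g g)).
transitivity (\int[gauss]_x phi (r * x)%R); last first.
  apply: eq_integral => x _; apply: eq_integral => g _.
  by rewrite tlin_cons mul0r addr0.
rewrite -gauss_stable; last 2 first.
- apply: (measurable_fun_integral _
    (fun z g => f (tcons (z, tlin r 0 g g)))) => //.
  apply: measurableT_comp => //; apply: mcons => //.
  exact: measurable_tlin.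
- by move=> z; exact: integral_ge0.
apply: eq_integral => x _.
transitivity (\int[power_prob gauss q]_g \int[gauss]_y
    \int[power_prob gauss q]_b f (tcons ((s * x + t * y)%R, tlin s t g b))).
  apply: eq_integral => g _; rewrite integral_power_probS//; last exact: mftl.
  by apply: eq_integral => y _; apply: eq_integral => b _; rewrite tlin_cons.
(* The head of the second vector is moved outside the tail of the first, so that the two tails
   become adjacent. *)
rewrite integral_swap; last 2 first.
- apply: (measurable_fun_integral _
    (fun z b => f (tcons ((s * x + t * z.2)%R, tlin s t z.1 b)))) => //.
  apply: measurableT_comp => //; apply: mcons => //.
    apply: measurable_funD => //; apply: measurable_funM => //.
    exact: measurableT_comp.
  by apply: measurable_tlin => //; exact: measurableT_comp.
- by move=> g y; exact: integral_ge0.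
apply: eq_integral => y _.
rewrite (IH (fun g => f (tcons ((s * x + t * y)%R, g))))//.
by apply: measurableT_comp => //; exact: mcons.
Qed.

Lemma integral_tdot q (v : 'I_q -> R) (f : R -> \bar R) :
  measurable_fun [set: R] f -> (forall x, 0 <= f x) ->
  \int[power_prob gauss q]_g f (tdot v g) =
  \int[gauss]_x f (vnorm v * x)%R.
Proof.
have mtd m (w : 'I_m -> R) (h : R -> \bar R) : measurable_fun [set: R] h ->
    measurable_fun [set: m.-tuple R] (fun g => h (tdot w g)).
  by move=> mh; apply: measurableT_comp => //; exact: measurable_tdot.
elim: q => [|q IH] in v f * => mf f0.
  rewrite (integral_power_prob0 _ (fun g => f (tdot v g))); last exact: mtd.
  rewrite /tdot /vnorm !big_ord0 sqrtr0.
  by under eq_integral do rewrite mul0r; rewrite integral_prob_cst.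
rewrite integral_power_probS//; last first.
  exact: mtd.
pose v' i := v (lift ord0 i).
transitivity (\int[gauss]_x \int[gauss]_y f (v ord0 * x + vnorm v' * y)%R).
  apply: eq_integral => x _.
  under eq_integral do rewrite tdot_cons.
  rewrite (IH v' (fun z => f (v ord0 * x + z)%R))//.
  by apply: measurableT_comp => //; exact: measurable_funD.
rewrite gauss_stable//; apply: eq_integral => x _; congr (f (_ * _)%R).
rewrite /vnorm sqr_sqrtr; last by apply: sumr_ge0 => i _; exact: sqr_ge0.
by rewrite big_ord_recl.
Qed.

(** This form of sqrt (2 / pi) cancels directly against the factor sqrt (2 pi) of the theorem. *)
Definition mean_abs : R := (2 * (Num.sqrt (pi *+ 2))^-1)%R.

Lemma integral_norm_tdot q (v : 'I_q -> R) :
  \int[power_prob gauss q]_g (`|tdot v g|%R)%:E = (mean_abs * vnorm v)%:E.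
Proof.
rewrite (integral_tdot _ v (fun x => (`|x|%R)%:E))//; last first.
  by apply/measurable_EFinP; exact: normr_measurable.
under eq_integral do rewrite normrM ger0_norm ?sqrtr_ge0// EFinM.
rewrite ge0_integralZl//.
- by rewrite integral_gauss_norm -EFinM mulrC.
- by apply/measurable_EFinP; exact: normr_measurable.
- by rewrite lee_fin sqrtr_ge0.
Qed.

End gaussian_vectors.

(** * Replacing the rows one at a time *)

Section countable_sup.
Context {R : realType}.
Local Open Scope ereal_scope.

Definition ssup (h : nat -> R) : \bar R := ereal_sup (range (EFin \o h)).

Lemma le_ssup (h : nat -> R) j : (h j)%:E <= ssup h.
Proof. by apply: ereal_sup_ubound; exists j. Qed.

Lemma ssup_le (h : nat -> R) z : (forall j, (h j)%:E <= z) -> ssup h <= z.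
Proof. by move=> hz; apply: ge_ereal_sup => _ [j _ <-]; exact: hz. Qed.

Lemma ssup_ge0 (h : nat -> R) : h 0%N = 0%R -> 0 <= ssup h.
Proof. by move=> h0; rewrite -[0]/(0%R%:E) -h0; exact: le_ssup. Qed.

Lemma measurable_ssup d (T : measurableType d) (h : T -> nat -> R) :
  (forall j, measurable_fun setT (fun w => h w j)) ->
  measurable_fun setT (fun w => ssup (h w)).
Proof.
move=> mh.
rewrite (_ : (fun _ => _) = fun w => esups (fun j => (h w j)%:E) 0%N).
  by apply: measurable_fun_esups => j; exact/measurable_EFinP.
apply/funext => w; congr ereal_sup.
by apply/seteqP; split=> x [j _ <-]; exists j.
Qed.

(** The indices j and k are independent, so the two suprema can be taken in turn; the case of
    infinite z is separate because real bounds are subtracted from z. *)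
Lemma ssupD_le (a b : nat -> R) z : 0 <= z ->
  (forall j k, (a j + b k)%:E <= z) -> ssup a + ssup b <= z.
Proof.
case: z => [z||]// _ abz; last by rewrite leey.
have az k : ssup a <= (z - b k)%:E.
  by apply: ssup_le => j; rewrite lee_fin lerBrDr -lee_fin.
have := le_ssup a 0%N; have := az 0%N.
case E : (ssup a) => [x||]// _ _.
rewrite addeC -leeBrDr// -EFinB; apply: ssup_le => j.
by move: (az j); rewrite E !lee_fin; lra.
Qed.

(** For indices j and k, |t j| - |t k| is at most |t j - t k|. The sign of t j - t k decides which
    of the two indices is used in the supremum with +t and which in the one with -t. *)
Lemma ssup_contraction (h t : nat -> R) : h 0%N = 0%R -> t 0%N = 0%R ->
  ssup (fun j => h j + `|t j|)%R + ssup (fun j => h j - `|t j|)%R <=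
  ssup (fun j => h j + t j)%R + ssup (fun j => h j - t j)%R.
Proof.
move=> h0 t0.
apply: ssupD_le => [|j k].
  by rewrite adde_ge0// ssup_ge0// h0 t0 ?addr0// subr0.
have [tjk|tjk] := lerP (t k) (t j).
- apply: (@le_trans _ _ ((h j + t j)%:E + (h k - t k)%:E)).
    rewrite -EFinD lee_fin.
    have := lerB_dist (t j) (t k).
    by rewrite (@ger0_norm _ (t j - t k)) ?subr_ge0//; lra.
  by apply: leeD; [exact: (le_ssup (fun j => h j + t j)%R)|
                   exact: (le_ssup (fun j => h j - t j)%R)].
- apply: (@le_trans _ _ ((h k + t k)%:E + (h j - t j)%:E)).
    rewrite -EFinD lee_fin.
    have := lerB_dist (t j) (t k).
    by rewrite (@ltr0_norm _ (t j - t k)) ?subr_lt0//; lra.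
  by apply: leeD; [exact: (le_ssup (fun j => h j + t j)%R)|
                   exact: (le_ssup (fun j => h j - t j)%R)].
Qed.

End countable_sup.

(** The constant k may be negative while M may have infinite integral. Moving -k to the other side
    when k < 0 keeps all integrands nonnegative. *)
Lemma le_integral_shift {R : realType} {d} {T : measurableType d}
    (P : probability T R) (k : R) (X : T -> R) (M : T -> \bar R) :
  measurable_fun setT X -> measurable_fun setT M ->
  (forall w, 0 <= X w) -> (forall w, (0 <= M w)%E) ->
  (forall w, ((k + X w)%:E <= M w)%E) ->
  (k%:E + \int[P]_w (X w)%:E <= \int[P]_w M w)%E.
Proof.
move=> mX mM X0 M0 kXM.
have mX' : measurable_fun setT (fun w => (X w)%:E) by exact/measurable_EFinP.
have [k0|k0] := leP 0 k.
- rewrite -{1}(integral_prob_cst P k%:E) -ge0_integralD//; last first.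
    by move=> w _; rewrite lee_fin.
  apply: ge0_le_integral => //; first by move=> w _; rewrite adde_ge0// lee_fin.
    exact: emeasurable_funD.
  by move=> w _; rewrite -EFinD.
- rewrite addeC -leeBrDr// -EFinN -[X in (_ + X)%E](integral_prob_cst P).
  have nk0 : (0 <= (- k)%:E)%E by rewrite lee_fin; lra.
  rewrite -ge0_integralD//.
  apply: ge0_le_integral => //; first by move=> w _; rewrite lee_fin.
    exact: emeasurable_funD.
  by move=> w _; rewrite EFinN leeBrDr// -EFinD addrC.
Qed.

Section row_replacement.
Context {R : realType} {q : nat}.
Variable v : nat -> 'I_q -> R.
Hypothesis v0 : forall i, v 0%N i = 0.
Local Open Scope ereal_scope.
Local Notation gam := (power_prob (@gauss R) q).

Let dot j (g : q.-tuple R) : R := tdot (v j) g.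

Let dot0 g : dot 0%N g = 0%R.
Proof. by rewrite /dot /tdot big1// => i _; rewrite v0 mul0r. Qed.

(* By [integral_norm_tdot], [mean_abs * vnorm (v j)] is the mean of
   [`|tdot (v j) g|]; hence a defect is centered. *)
Definition defect j (g : q.-tuple R) : R :=
  (mean_abs * vnorm (v j) - `|tdot (v j) g|)%R.

Let vnorm0 : vnorm (v 0%N) = 0%R.
Proof. by rewrite /vnorm big1 ?sqrtr0// => i _; rewrite v0 expr0n. Qed.

Lemma defect0 g : defect 0%N g = 0%R.
Proof. by rewrite /defect vnorm0 mulr0 -/(dot _ _) dot0 normr0 subr0. Qed.

Let mdot d (T : measurableType d) j (g : T -> q.-tuple R) :
  measurable_fun setT g -> measurable_fun setT (fun w => dot j (g w)).
Proof. exact: measurable_tdot. Qed.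

Let mndot d (T : measurableType d) j (g : T -> q.-tuple R) :
  measurable_fun setT g -> measurable_fun setT (fun w => `|dot j (g w)|)%R.
Proof. by move=> mg; apply: measurableT_comp => //; exact: mdot. Qed.

Let integral_ssup_sym (h : nat -> R) : h 0%N = 0%R ->
  \int[gam]_g ssup (fun j => h j - 2 * dot j g)%R =
  \int[gam]_g ssup (fun j => h j + 2 * dot j g)%R.
Proof.
move=> h0; pose f g := ssup (fun j => h j + 2 * dot j g)%R.
(* The weights -1 and 0 turn stability into the statement that -g has the law of g. *)
have := @gauss_vector_stable R q (-1) 0 f.
rewrite sqrrN expr1n expr0n addr0 sqrtr1 => stable.
transitivity (\int[gam]_g \int[gam]_b f (tlin (-1) 0 g b)).
  apply: eq_integral => g _; rewrite -[LHS](integral_prob_cst gam).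
  apply: eq_integral => b _; congr ssup; apply/funext => j.
  by rewrite /dot tdot_tlin; lra.
rewrite stable; last 2 first.
- apply: measurable_ssup => j; apply: measurable_funD => //.
  by apply: measurable_funM => //; exact: mdot.
- by move=> g; apply: ssup_ge0; rewrite dot0 h0; lra.
apply: eq_integral => g _; congr ssup; apply/funext => j.
by rewrite /dot tdot_tlin; lra.
Qed.

(* Symmetrization and contraction for a single row: an independent copy b
   replaces the mean, convexity splits |<v_j, b>| - |<v_j, g>| into two halves
   2|<v_j, b>| and - 2|<v_j, g>|, and [ssup_contraction] removes the absolute
   values. *)
Lemma integral_ssup_defect (h : nat -> R) : h 0%N = 0%R ->
  \int[gam]_g ssup (fun j => h j + defect j g)%R <=
  \int[gam]_g ssup (fun j => h j + 2 * tdot (v j) g)%R.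
Proof.
move=> h0.
have mabs d (T : measurableType d) (s : R) (g : T -> q.-tuple R) :
    measurable_fun setT g ->
    measurable_fun setT (fun w => ssup (fun j => h j + s * `|dot j (g w)|)%R).
  move=> mg; apply: measurable_ssup => j; apply: measurable_funD => //.
  by apply: measurable_funM => //; exact: mndot.
have mlin (s : R) :
    measurable_fun setT (fun g => ssup (fun j => h j + s * dot j g)%R).
  apply: measurable_ssup => j; apply: measurable_funD => //.
  by apply: measurable_funM => //; exact: mdot.
have abs0 (s : R) g : 0 <= ssup (fun j => h j + s * `|dot j g|)%R.
  by apply: ssup_ge0; rewrite dot0 normr0 h0; lra.
have lin0 (s : R) g : 0 <= ssup (fun j => h j + s * dot j g)%R.
  by apply: ssup_ge0; rewrite dot0 h0; lra.
have mdiff : measurable_fun setT (fun z : q.-tuple R * q.-tuple R =>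
    ssup (fun j => h j + (`|dot j z.2| - `|dot j z.1|))%R).
  apply: measurable_ssup => j; apply: measurable_funD => //.
  by apply: measurable_funB; exact: mndot.
have diff0 g b : 0 <= ssup (fun j => h j + (`|dot j b| - `|dot j g|))%R.
  by apply: ssup_ge0; rewrite !dot0 normr0 h0; lra.
apply: (@le_trans _ _ (\int[gam]_g \int[gam]_b
    ssup (fun j => h j + (`|dot j b| - `|dot j g|))%R)).
  apply: ge0_le_integral => //.
  - by move=> g _; apply: ssup_ge0; rewrite defect0 h0 addr0.
  - apply: measurable_ssup => j; apply: measurable_funD => //.
    by apply: measurable_funB => //; exact: mndot.
  - exact: (measurable_fun_integral _ (fun g b => ssup (fun j => _))).
  move=> g _; apply: ssup_le => j.
  have := @le_integral_shift _ _ _ gam (h j - `|dot j g|)%R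
    (fun b => `|dot j b|)%R
    (fun b => ssup (fun j => h j + (`|dot j b| - `|dot j g|))%R).
  rewrite integral_norm_tdot -EFinD.
  rewrite (_ : h j - `|dot j g| + mean_abs * vnorm (v j) = h j + defect j g)%R;
    last by rewrite /defect /dot; ring.
  apply => //; first exact: mndot.
    exact: (measurableT_comp mdiff (measurable_pair1 g)).
  move=> b; apply: le_trans (le_ssup _ j); rewrite lee_fin; lra.
pose half : R := (2^-1)%R.
have half0 : 0 <= half%:E by rewrite lee_fin invr_ge0.
pose A b := ssup (fun j => h j + 2 * `|dot j b|)%R.
pose B g := ssup (fun j => h j + - 2 * `|dot j g|)%R.
have mA : measurable_fun setT A by exact: mabs.
have mB : measurable_fun setT B by exact: mabs.
have hA0 b : 0 <= half%:E * A b by rewrite mule_ge0// abs0.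
have hB0 b : 0 <= half%:E * B b by rewrite mule_ge0// abs0.
have mhA : measurable_fun setT (fun b => half%:E * A b).
  exact: measurable_funeM.
have mhB : measurable_fun setT (fun b => half%:E * B b).
  exact: measurable_funeM.
apply: (@le_trans _ _ (\int[gam]_g \int[gam]_b
    (half%:E * A b + half%:E * B g))).
  apply: ge0_le_integral => //.
  - by move=> g _; exact: integral_ge0.
  - exact: (measurable_fun_integral _
      (fun g b => ssup (fun j => h j + (`|dot j b| - `|dot j g|))%R)).
  - apply: (measurable_fun_integral _
      (fun g b => half%:E * A b + half%:E * B g)) => //.
      apply: emeasurable_funD.
        exact: (measurableT_comp mhA measurable_snd).
      exact: (measurableT_comp mhB measurable_fst).
    by move=> g b; rewrite adde_ge0.
  move=> g _; apply: ge0_le_integral => //.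
  - exact: (measurableT_comp mdiff (measurable_pair1 g)).
  - exact: emeasurable_funD.
  move=> b _; apply: ssup_le => j.
  apply: (@le_trans _ _ (half%:E * (h j + 2 * `|dot j b|)%R%:E +
                         half%:E * (h j + - 2 * `|dot j g|)%R%:E)).
    by rewrite -!EFinM -EFinD lee_fin /half; lra.
  by apply: leeD; apply: lee_wpmul2l => //;
    [exact: (le_ssup (fun j => h j + 2 * `|dot j b|)%R)|
     exact: (le_ssup (fun j => h j + - 2 * `|dot j g|)%R)].
have split_ g : \int[gam]_b (half%:E * A b + half%:E * B g) =
    \int[gam]_b (half%:E * A b) + half%:E * B g.
  by rewrite ge0_integralD// integral_prob_cst.
under eq_integral do rewrite split_.
rewrite ge0_integralD//; last by move=> g _; exact: integral_ge0.
(* Each half depends on one vector only, and b and g have the same law. Both halves can therefore be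
   integrated over a common g, as the pointwise contraction requires. *)
rewrite integral_prob_cst -ge0_integralD//.
apply: (@le_trans _ _ (\int[gam]_g
    (half%:E * ssup (fun j => h j + 2 * dot j g)%R +
     half%:E * ssup (fun j => h j + - 2 * dot j g)%R))).
  apply: ge0_le_integral => //.
  - by move=> g _; rewrite adde_ge0.
  - exact: emeasurable_funD.
  - by apply: emeasurable_funD; exact: measurable_funeM.
  move=> g _; have A0 : 0 <= A g := abs0 _ g.
  have B0 : 0 <= B g := abs0 _ g.
  rewrite -!ge0_muleDr//; apply: lee_wpmul2l => //.
  have := @ssup_contraction _ h (fun j => 2 * dot j g)%R h0.
  rewrite dot0 mulr0 => /(_ erefl).
  rewrite /A /B => contr; apply: le_trans (le_trans contr _).
    by apply: leeD; rewrite le_eqVlt; apply/orP; left; apply/eqP; congr ssup;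
      apply/funext => j; rewrite normrM (@ger0_norm _ 2)// mulNr.
  by apply: leeD => //; rewrite le_eqVlt; apply/orP; left; apply/eqP;
    congr ssup;
    apply/funext => j; rewrite mulNr.
rewrite ge0_integralD//; first last.
- exact: measurable_funeM.
- by move=> g _; rewrite mule_ge0.
- exact: measurable_funeM.
- by move=> g _; rewrite mule_ge0.
rewrite !ge0_integralZl//.
have -> : \int[gam]_g ssup (fun j => h j + - 2 * dot j g)%R =
          \int[gam]_g ssup (fun j => h j + 2 * dot j g)%R.
  rewrite -integral_ssup_sym//; apply: eq_integral => g _.
  by congr ssup; apply/funext => j; rewrite mulNr.
by rewrite -ge0_muleDl// -EFinD /half (_ : _ + _ = 1)%R ?mul1e//; lra.
Qed.

Lemma measurable_defect d (T : measurableType d) j (g : T -> q.-tuple R) :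
  measurable_fun setT g -> measurable_fun setT (fun w => defect j (g w)).
Proof. by move=> mg; apply: measurable_funB => //; exact: mndot. Qed.

(** The offset is generalized in the induction. With the first row b frozen, its defect joins the
    offset and the other n rows become 2 sqrt n g; with g frozen in turn, [integral_ssup_defect]
    replaces row b by 2 b. Stability then merges sqrt n g + b. *)
Lemma integral_ssup_rows n (h : nat -> R) : h 0%N = 0%R ->
  \int[power_prob gam n]_B
    ssup (fun j => h j + \sum_(i < n) defect j (tnth B i))%R
  <= \int[gam]_g ssup (fun j => h j + 2 * Num.sqrt n%:R * tdot (v j) g)%R.
Proof.
elim: n => [|n IH] in h * => h0.
  rewrite (eq_integral (fun=> ssup h)); last first.
    by move=> B _; congr ssup; apply/funext => j; rewrite big_ord0 addr0.
  rewrite [leRHS](eq_integral (fun=> ssup h)) ?integral_prob_cst//.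
  move=> g _; congr ssup; apply/funext => j.
  by rewrite sqrtr0 mulr0 mul0r addr0.
have mrows d (T : measurableType d) m (k : nat -> T -> R)
    (B : T -> m.-tuple (q.-tuple R)) :
    (forall j, measurable_fun setT (k j)) -> measurable_fun setT B ->
    measurable_fun setT (fun w =>
      ssup (fun j => k j w + \sum_(i < m) defect j (tnth (B w) i))%R).
  move=> mk /measurable_fun_tnthP mB.
  apply: measurable_ssup => j; apply: measurable_funD => //.
  by apply: measurable_sum => i; apply: measurable_defect; exact: mB.
have rows0 m (k : nat -> R) (B : m.-tuple (q.-tuple R)) : k 0%N = 0%R ->
    0 <= ssup (fun j => k j + \sum_(i < m) defect j (tnth B i))%R.
  move=> k0; apply: ssup_ge0; rewrite k0 add0r big1// => i _; exact: defect0.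
rewrite integral_power_probS; last 2 first.
- by apply: (mrows _ _ _ (fun j _ => h j)) => // j; exact: measurable_cst.
- by move=> B; exact: rows0.
pose s : R := (2 * Num.sqrt n%:R)%R.
have shift0 g : (h 0 + defect 0 g = 0)%R by rewrite h0 defect0 addr0.
have shift_ge0 (c : R) b g :
    0 <= ssup (fun j => h j + defect j b + c * tdot (v j) g)%R.
  by apply: ssup_ge0; rewrite shift0 -/(dot _ _) dot0 mulr0 addr0.
have mshift (T : measurableType _) (u w : T -> q.-tuple R) (c : R) :
    measurable_fun setT u -> measurable_fun setT w ->
    measurable_fun setT (fun t =>
      ssup (fun j => h j + defect j (u t) + c * tdot (v j) (w t))%R).
  move=> mu mw; apply: measurable_ssup => j; apply: measurable_funD.
    by apply: measurable_funD => //; exact: measurable_defect.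
  by apply: measurable_funM => //; exact: mdot.
apply: (@le_trans _ _ (\int[gam]_b \int[gam]_g
    ssup (fun j => h j + defect j b + s * tdot (v j) g)%R)).
  apply: ge0_le_integral => //.
  - by move=> b _; apply: integral_ge0 => B _; exact: rows0.
  - apply: (measurable_fun_integral _ (fun b B => ssup (fun j =>
      h j + \sum_(i < n.+1) defect j (tnth (tcons (b, B)) i))%R)).
      apply: (mrows _ _ _ (fun j _ => h j) (fun z => tcons (z.1, z.2))).
        by move=> j; exact: measurable_cst.
      exact: (measurable_cons measurable_fst measurable_snd).
    by move=> b B; exact: rows0.
  - apply: (measurable_fun_integral _ (fun b g =>
      ssup (fun j => h j + defect j b + s * tdot (v j) g)%R)).
      exact: mshift.
    by move=> b g; exact: shift_ge0.
  move=> b _; rewrite (eq_integral (fun B => ssup (fun j =>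
      h j + defect j b + \sum_(i < n) defect j (tnth B i))%R)).
    exact: IH.
  move=> B _; congr ssup; apply/funext => j.
  rewrite big_ord_recl addrA /tcons/=; congr (_ + _)%R.
  by apply: eq_bigr => i _; rewrite tnthS.
(* Row b has to be the inner variable now, with the Gaussian term in g serving as part of its
   offset. *)
rewrite integral_swap; last 2 first.
- exact: mshift.
- by move=> b g; exact: shift_ge0.
pose f g := ssup (fun j => h j + 2 * tdot (v j) g)%R.
have f0 g : 0 <= f g.
  by apply: ssup_ge0; rewrite h0 -/(dot _ _) dot0; lra.
have mf : measurable_fun setT f.
  apply: measurable_ssup => j; apply: measurable_funD => //.
  by apply: measurable_funM => //; exact: mdot.
apply: (@le_trans _ _ (\int[gam]_g \int[gam]_b
    f (tlin (Num.sqrt n%:R) 1 g b))).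
  apply: ge0_le_integral => //.
  - by move=> g _; apply: integral_ge0 => b _; exact: shift_ge0.
  - apply: (measurable_fun_integral _ (fun g b =>
      ssup (fun j => h j + defect j b + s * tdot (v j) g)%R)).
      exact: mshift.
    by move=> g b; exact: shift_ge0.
  - apply: (measurable_fun_integral _
      (fun g b => f (tlin (Num.sqrt n%:R) 1 g b))) => //.
    by apply: measurableT_comp => //; exact: measurable_tlin.
  move=> g _.
  have := @integral_ssup_defect (fun j => h j + s * dot j g)%R.
  rewrite dot0 mulr0 addr0 => /(_ h0).
  rewrite (eq_integral (fun b =>
    ssup (fun j => h j + defect j b + s * tdot (v j) g)%R)); last first.
    by move=> b _; congr ssup; apply/funext => j; rewrite addrAC.
  move=> /le_trans; apply; rewrite le_eqVlt; apply/orP; left; apply/eqP.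
  apply: eq_integral => b _; congr ssup; apply/funext => j.
  by rewrite tdot_tlin /s /dot; ring.
rewrite gauss_vector_stable// sqr_sqrtr ?ler0n// expr1n natr1.
rewrite (eq_integral (fun g => ssup
  (fun j => h j + 2 * Num.sqrt n.+1%:R * tdot (v j) g)%R))//.
move=> g _; congr ssup; apply/funext => j.
by rewrite tdot_tlin; ring.
Qed.

End row_replacement.

(** * Reduction to a countable family *)

Lemma rat_near {R : realType} (x e : R) :
  0 < e -> exists r : rat, `|x - ratr r| < e.
Proof.
move=> e0; have [|r] := @rat_in_itvoo R (x - e) (x + e); first by lra.
rewrite in_itv/= => /andP[? ?]; exists r.
by rewrite ltr_norml; apply/andP; split; lra.
Qed.

Section dense_sequence.
Context {R : realType} {q : nat}.

Let close (e : R) (x y : 'cV[R]_q) := forall i, `|x i 0 - y i 0| < e.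

(** [V] is arbitrary and may miss all rational points. For each precision 1 / (k + 1) and each
    rational vector r, a point of [V] that close to r is chosen if one exists, and 0 otherwise; the
    pairs (k, r) are countable. *)
Lemma dense_sequence (V : set 'cV[R]_q) : V 0 ->
  exists v : nat -> 'cV[R]_q, [/\ v 0%N = 0, forall j, V (v j) &
    forall x e, V x -> 0 < e -> exists j, forall i, `|x i 0 - v j i 0| < e].
Proof.
move=> V0.
pose near_code m y := forall k (r : 'cV[rat]_q),
  unpickle m = Some (k, r) ->
  (exists2 x, V x & close k.+1%:R^-1 x (map_mx ratr r)) ->
  close k.+1%:R^-1 y (map_mx ratr r).
have /choice[v Vv] m : exists y, V y /\ near_code m y.
  case E : (@unpickle (nat * 'cV[rat]_q)%type m) => [[k r]|]; last first.
    by exists 0; split=> // k r; rewrite E.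
  have [[x Vx xr]|nx] :=
      pselect (exists2 x, V x & close k.+1%:R^-1 x (map_mx ratr r)).
    by exists x; split=> // k' r'; rewrite E => -[<- <-].
  by exists 0; split=> // k' r'; rewrite E => -[<- <-].
(* Codes are shifted by one to reserve index 0 for the zero vector. *)
exists (fun m => if m is m'.+1 then v m' else 0); split=> //.
  by case=> // m; have [] := Vv m.
move=> x e Vx e0.
(* The factor 2 pays for two errors: from x to the rational vector, and from there to the chosen
   point. *)
pose k := Num.bound (2 / e).
have ke : 2 / k.+1%:R < e.
  rewrite ltr_pdivrMr// mulrC -ltr_pdivrMr//.
  have e2 : 0 <= 2 / e by rewrite divr_ge0// ltW.
  by rewrite (lt_trans (archi_boundP e2))// ltr_nat.
have k0 : 0 < k.+1%:R^-1 :> R by rewrite invr_gt0.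
have /choice[r xr] i := rat_near (x i 0) _ k0.
pose M : 'cV[rat]_q := \col_i r i.
have [_ /(_ k M)] := Vv (pickle (k, M)).
rewrite pickleK => /(_ erefl) H.
exists (pickle (k, M)).+1 => i.
have xM : close k.+1%:R^-1 x (map_mx ratr M).
  by move=> j; rewrite !mxE; exact: xr.
have vz := H (ex_intro2 _ _ x Vx xM) i.
have xz := xM i.
apply: le_lt_trans (ler_distD (map_mx ratr M i 0) _ _) _.
rewrite (distrC _ (v _ _ _)); apply: lt_trans ke.
by rewrite mulr_natl mulr2n ltrD.
Qed.

End dense_sequence.

Section lipschitz.
Context {R : realType} {q : nat}.
Implicit Types x y : 'I_q -> R.

Lemma le_vnorm x i : `|x i| <= vnorm x.
Proof.
rewrite -sqrtr_sqr ler_sqrt; last by apply: sumr_ge0 => j _; exact: sqr_ge0.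
by rewrite (bigD1 i)//= lerDl; apply: sumr_ge0 => j _; exact: sqr_ge0.
Qed.

(** After squaring, the bound holds term by term, because |y i| is at most [vnorm y] and each |x i -
    y i| is at most their sum. *)
Lemma vnorm_lipschitz x y : vnorm x <= vnorm y + \sum_i `|x i - y i|.
Proof.
have D0 : 0 <= \sum_i `|x i - y i| by exact: sumr_ge0.
have y0 : 0 <= vnorm y by exact: sqrtr_ge0.
rewrite -(ler_pXn2r (n := 2))// ?nnegrE ?sqrtr_ge0 ?addr_ge0//.
have S0 z : 0 <= \sum_(i < q) z i ^+ 2 :> R.
  by apply: sumr_ge0 => j _; exact: sqr_ge0.
rewrite {1}/vnorm sqr_sqrtr// sqrrD {1}/vnorm sqr_sqrtr//.
rewrite -mulrnAr -addrA.
have dD i : `|x i - y i| <= \sum_i `|x i - y i|.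
  by rewrite [leRHS](bigD1 i)//= lerDl; exact: sumr_ge0.
set D := \sum_i `|x i - y i| in D0 dD *.
have -> : vnorm y * (D *+ 2) + D ^+ 2 =
    \sum_i `|x i - y i| * (vnorm y *+ 2 + D).
  by rewrite -mulr_suml -/D; ring.
rewrite -big_split/=; apply: ler_sum => i _.
have e : x i ^+ 2 =
    y i ^+ 2 + 2 * (y i * (x i - y i)) + `|x i - y i| ^+ 2.
  by rewrite real_normK ?num_real//; ring.
have h1 : y i * (x i - y i) <= vnorm y * `|x i - y i|.
  apply: le_trans (ler_norm _) _; rewrite normrM.
  by apply: ler_wpM2r => //; exact: le_vnorm.
have h2 : `|x i - y i| ^+ 2 <= `|x i - y i| * D.
  by rewrite expr2; apply: ler_wpM2l.
rewrite e; move: h1 h2; move: (`|x i - y i|) => a; lra.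
Qed.

Lemma tdot_lipschitz x y (b : q.-tuple R) :
  `|tdot y b| <= `|tdot x b| + \sum_i `|x i - y i| * `|tnth b i|.
Proof.
have -> : tdot y b = tdot x b + \sum_i (y i - x i) * tnth b i.
  by rewrite /tdot -big_split/=; apply: eq_bigr => i _; ring.
apply: le_trans (ler_normD _ _) _; rewrite lerD2l.
apply: le_trans (ler_norm_sum _ _ _) _; apply: ler_sum => i _.
by rewrite normrM distrC.
Qed.

End lipschitz.

Section lower_integral.
Local Open Scope ereal_scope.

(* No measurability is needed: the integral of a nonnegative function is the
   supremum of the integrals of the simple functions below it. *)
Lemma le_lower_integral {R : realType} {d} {T : measurableType d}
    (mu : {measure set T -> \bar R}) (f g : T -> \bar R) :
  (forall w, 0 <= f w) -> (forall w, f w <= g w) ->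
  \int[mu]_w f w <= \int[mu]_w g w.
Proof.
move=> f0 fg; have g0 w : 0 <= g w := le_trans (f0 w) (fg w).
rewrite !ge0_integralTE//; apply: le_ereal_sup => _ [h hf <-].
by exists h => // w; exact: le_trans (hf w) (fg w).
Qed.

End lower_integral.

Lemma integral_gaussian_vector {R : realType} {d} {T : measurableType d}
    (P : probability T R) (q : nat) (g : T -> 'cV[R]_q)
    (f : q.-tuple R -> \bar R) :
  std_gaussian_matrix P g ->
  measurable_fun [set: q.-tuple R] f -> (forall t, (0 <= f t)%E) ->
  (\int[P]_w f [tuple g w i ord0 | i < q] =
   \int[power_prob gauss q]_t f t)%E.
Proof.
move=> [mg lawg indg] mf f0.
(* Transposed, the column is a matrix with a single row, so the matrix transfer applies with
   [m = 1]. *)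
have hgT : std_gaussian_matrix P (fun w => (g w)^T).
  split.
  - by move=> i j; under eq_fun do rewrite mxE; exact: mg.
  - by move=> i j E mE; rewrite -(lawg j i E mE); congr (P _);
      apply/funext => w /=; rewrite mxE.
  - move=> E mE.
    transitivity (P [set w | forall i j, E j i (g w i j)]).
      congr (P _); apply/seteqP; split=> w /= h i j.
        by have := h j i; rewrite mxE.
      by rewrite mxE; exact: h.
    rewrite (indg (fun i j => E j i))// exchange_big.
    apply: eq_bigr => i _; apply: eq_bigr => j _.
    by congr (P _); apply/funext => w /=; rewrite mxE.
have mf' : measurable_fun [set: 1.-tuple (q.-tuple R)]
    (fun t => f (tnth t ord0)).
  by apply: measurableT_comp => //; exact: measurable_tnth.
have := @integral_gaussian_matrix _ _ _ P 1 q _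
  (fun t => f (tnth t ord0)) hgT mf'.
rewrite integral_power_probS// => E.
transitivity (\int[P]_w f (tnth (mxrows (g w)^T) ord0))%E.
  apply: eq_integral => w _; congr f; apply/eq_from_tnth => i.
  by rewrite !tnth_mktuple mxE.
rewrite E//; apply: eq_integral => t _.
exact: (integral_prob_cst (power_prob (power_prob gauss q) 0) (f t)).
Qed.

(** For fixed [B] the sum of defects varies by at most M times the largest change of an entry of the
    vector, so a nearby member of the sequence loses arbitrarily little. *)
Lemma le_ssup_dense {R : realType} {n q : nat} (B : 'M[R]_(n, q))
    (V : set 'cV[R]_q) (v : nat -> 'cV[R]_q) :
  (forall x e, V x -> 0 < e -> exists j, forall i, `|x i 0 - v j i 0| < e) ->
  forall x, V x ->
  ((\sum_(i < n) (mean_abs * vnorm (fun k => x k 0) -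
      `|tdot (fun k => x k 0) (tnth (mxrows B) i)|))%:E <=
   ssup (fun j => 0 + \sum_(i < n)
      defect (fun j k => v j k 0) j (tnth (mxrows B) i))%R)%E.
Proof.
move=> dense x Vx.
have c0 : 0 <= mean_abs :> R by rewrite mulr_ge0// invr_ge0 sqrtr_ge0.
pose M : R := \sum_(i < n) (mean_abs * q%:R + \sum_(k < q) `|B i k|).
have M0 : 0 <= M.
  by apply: sumr_ge0 => i _; rewrite addr_ge0 ?mulr_ge0 ?ler0n// sumr_ge0.
apply/lee_addgt0Pr => e e0.
(* M may vanish, hence the added 1. *)
have eM : 0 < e / (M + 1) by rewrite divr_gt0//; lra.
have [j xj] := dense x _ Vx eM.
apply: le_trans (leeD2r e%:E (le_ssup _ j)); rewrite -EFinD lee_fin add0r.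
have : e / (M + 1) * M <= e.
  by rewrite mulrAC ler_pdivrMr; [apply: ler_wpM2l; lra|lra].
move=> eMe.
apply: (@le_trans _ _ (\sum_(i < n)
  (defect (fun j k => v j k 0) j (tnth (mxrows B) i) +
   e / (M + 1) * (mean_abs * q%:R + \sum_(k < q) `|B i k|)))).
  apply: ler_sum => i _; rewrite /defect.
  have nx := vnorm_lipschitz (fun k => x k 0) (fun k => v j k 0).
  have dx := tdot_lipschitz (fun k => x k 0) (fun k => v j k 0)
    (tnth (mxrows B) i).
  have dn : \sum_k `|x k 0 - v j k 0| <= e / (M + 1) * q%:R.
    rewrite mulr_natr -[X in _ <= _ *+ X]card_ord -sumr_const.
    by apply: ler_sum => k _; exact: ltW.
  have dd : \sum_k `|x k 0 - v j k 0| * `|tnth (tnth (mxrows B) i) k| <=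
      e / (M + 1) * \sum_(k < q) `|B i k|.
    rewrite mulr_sumr; apply: ler_sum => k _; rewrite !tnth_mktuple.
    by apply: ler_wpM2r => //; exact: ltW.
  have := ler_wpM2l c0 (le_trans nx (lerD (lexx _) dn)).
  lra.
rewrite big_split/= -mulr_sumr -/M; lra.
Qed.

(** * Feasible pairs and the final bound *)

Lemma ler_l1normD {R : realType} m (x y : 'cV[R]_m) :
  l1norm (x + y) <= l1norm x + l1norm y.
Proof.
by rewrite -big_split/=; apply: ler_sum => i _; rewrite mxE ler_normD.
Qed.

Lemma l1norm0 {R : realType} m : l1norm (0 : 'cV[R]_m) = 0.
Proof. by rewrite /l1norm big1// => i _; rewrite mxE normr0. Qed.

(** The defects of x sum to n [mean_abs] |x| - |B x|_1, and sqrt (2 pi) / (2 n) is the inverse of n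
    [mean_abs]. The summand 0 in the supremum is the initial offset of [integral_ssup_rows]. *)
Lemma vnorm_le_ssup_defect {R : realType} {n q : nat} (n_gt0 : (0 < n)%N)
    (B : 'M[R]_(n, q)) (V : set 'cV[R]_q) (v : nat -> 'cV[R]_q) (eps : R) (x : 'cV[R]_q) :
  (forall x e, V x -> 0 < e -> exists j, forall i, `|x i 0 - v j i 0| < e) ->
  V x -> l1norm (B *m x) <= n%:R * (2 * eps) ->
  ((vnorm (fun k => x k 0))%:E <=
    (Num.sqrt (pi *+ 2) * eps)%:E + (Num.sqrt (pi *+ 2) / (2 * n%:R))%:E *
   ssup (fun j => 0 + \sum_(i < n)
      defect (fun j k => v j k 0) j (tnth (mxrows B) i))%R)%E.
Proof.
move=> dense Vx Bx.
have := le_ssup_dense B V v dense x Vx.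
set S := ssup _ => xS.
set kappa : R := Num.sqrt (pi *+ 2).
have k0 : 0 < kappa by rewrite sqrtr_gt0 mulrn_wgt0// pi_gt0.
have n0 : 0 < n%:R :> R by rewrite ltr0n.
have kn : (0 <= (kappa / (2 * n%:R))%:E)%E.
  by rewrite lee_fin divr_ge0 ?mulr_ge0 ?ltW.
apply: le_trans (leeD2l _ (lee_wpmul2l kn xS)).
rewrite -EFinM -EFinD lee_fin sumrB sumr_const card_ord.
rewrite -[(_ * _) *+ n]mulr_natr.
have -> : \sum_(i < n) `|tdot (fun k => x k 0) (tnth (mxrows B) i)| =
    l1norm (B *m x).
  apply: eq_bigr => i _; rewrite !mxE; congr (`|_|).
  by apply: eq_bigr => k _; rewrite !tnth_mktuple mulrC.
have -> : kappa / (2 * n%:R) * (mean_abs * vnorm (fun k => x k 0) * n%:R -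
    l1norm (B *m x)) = vnorm (fun k => x k 0) -
    kappa / (2 * n%:R) * l1norm (B *m x).
  by rewrite /mean_abs -/kappa; field; rewrite !gt_eqF.
have : kappa / (2 * n%:R) * l1norm (B *m x) <= kappa * eps.
  have -> : kappa * eps = kappa / (2 * n%:R) * (n%:R * (2 * eps)).
    by field; rewrite gt_eqF.
  by apply: ler_wpM2l.
lra.
Qed.

Theorem theorem6 (R : realType) (n q p : nat) (n_gt0 : (0 < n)%N)
  (d : measure_display) (T : measurableType d) (P : probability T R)
  (B : T -> 'M[R]_(n, q)) (hB : std_gaussian_matrix P B)
  (d' : measure_display) (T' : measurableType d') (P' : probability T' R)
  (g : T' -> 'M[R]_(q, 1)) (hg : std_gaussian_matrix P' g)
  (C : 'M[R]_(q, p)) (K : set 'cV[R]_p) (eps : R) (eps_ge0 : 0 <= eps) :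
  (\int[P]_w ereal_sup
     [set r : \bar R | exists (xs : 'cV[R]_p) (nu : 'cV[R]_n) (xh : 'cV[R]_p),
        [/\ K xs, K xh,
            ((n%:R)^-1 * l1norm nu <= eps)%R,
            ((n%:R)^-1 * l1norm (B w *m C *m xh - (B w *m C *m xs + nu)) <= eps)%R &
            r = (Num.sqrt (((xh - xs)^T *m C^T *m C *m (xh - xs)) 0 0))%:E]]
   <= (Num.sqrt (pi *+ 2))%:E *
      ((\int[P']_w ereal_sup
          [set `| ((C^T *m g w)^T *m u) 0 0 |%:E | u in mdiff K])
         * ((Num.sqrt (n%:R))^-1)%:E + eps%:E))%E.
Proof.
(* For empty [K] the left supremum is -oo; otherwise [mdiff K] contains 0. *)
have [->|/set0P[a Ka]] := eqVneq K set0.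
  rewrite (_ : (fun w => ereal_sup _) = fun=> -oo%E); last first.
    apply/funext => w; rewrite -ereal_sup0; congr ereal_sup.
    by apply/seteqP; split=> // r [? [? [? []]]].
  by rewrite integral_prob_cst leNye.
pose V : set 'cV[R]_q := [set C *m u | u in mdiff K].
have V0 : V 0.
  exists 0; last by rewrite mulmx0.
  by exists a, a; split=> //; rewrite subrr.
have [v [v0 Vv dense]] := dense_sequence V V0.
pose cv j k : R := v j k 0.
have cv0 k : cv 0%N k = 0 by rewrite /cv v0 mxE.
set kappa : R := Num.sqrt (pi *+ 2).
have k0 : 0 < kappa by rewrite sqrtr_gt0 mulrn_wgt0// pi_gt0.
have n0 : 0 < n%:R :> R by rewrite ltr0n.
pose S (b : n.-tuple (q.-tuple R)) :=
  ssup (fun j => 0 + \sum_(i < n) defect cv j (tnth b i)).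
have S0 b : (0 <= S b)%E.
  apply: ssup_ge0; rewrite add0r big1// => i _; exact: defect0.
have mS : measurable_fun setT S.
  apply: measurable_ssup => j; apply: measurable_funD => //.
  apply: measurable_sum => i; apply: measurable_defect => //.
  exact: measurable_tnth.
pose W (t : q.-tuple R) := ssup (fun j => tdot (cv j) t).
have W0 t : (0 <= W t)%E.
  by apply: ssup_ge0; rewrite /tdot big1// => k _; rewrite cv0 mul0r.
have mW : measurable_fun setT W.
  by apply: measurable_ssup => j; exact: measurable_tdot.
pose G w := ereal_sup [set `|((C^T *m g w)^T *m u) 0 0|%:E | u in mdiff K].
(* [W] has no absolute values and runs over a sequence in C (K - K), so it stays below [G]. *)
have WG w : (W [tuple g w i ord0 | i < q] <= G w)%E.
  apply: ssup_le => j; have [u Ku uv] := Vv j.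
  apply: le_trans (ereal_sup_ubound _); last by exists u => //; reflexivity.
  rewrite lee_fin; apply: le_trans (ler_norm _) _.
  rewrite trmx_mul trmxK -mulmxA uv mxE.
  rewrite le_eqVlt; apply/orP; left; apply/eqP; congr (`|_|).
  by apply: eq_bigr => k _; rewrite !mxE tnth_mktuple mulrC.
have G0 w : (0 <= G w)%E := le_trans (W0 _) (WG w).
apply: (@le_trans _ _ (\int[P]_w ((kappa * eps)%:E +
    (kappa / (2 * n%:R))%:E * S (mxrows (B w))))%E).
  apply: le_lower_integral => w.
    (* Noiseless exact recovery of [a] is feasible with error 0, so the left supremum is
       nonnegative. *)
    apply: ereal_sup_ubound; exists a, 0, a; split=> //.
    - by rewrite l1norm0 mulr0.
    - by rewrite addr0 subrr l1norm0 mulr0.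
    - by rewrite subrr mulmx0 mxE sqrtr0.
  apply: ge_ereal_sup => _ [xs [nu [xh [Kxs Kxh nue xhe ->]]]].
  pose x := C *m (xh - xs).
  have Vx : V x by exists (xh - xs) => //; exists xh, xs.
  rewrite (_ : Num.sqrt _ = vnorm (fun k => x k 0)); last first.
    rewrite /vnorm -trmx_mul -mulmxA -/x mxE; congr Num.sqrt.
    by apply: eq_bigr => k _; rewrite mxE expr2.
  apply: (vnorm_le_ssup_defect n_gt0 _ _ v eps x dense Vx).
  (* Residual plus noise: each has l1 norm at most n eps, whence the factor 2. *)
  have -> : B w *m x = B w *m C *m xh - (B w *m C *m xs + nu) + nu.
    by rewrite opprD addrA subrK /x mulmxA mulmxBr.
  apply: le_trans (ler_l1normD _ _ _) _.
  move: nue xhe; rewrite !ler_pdivrMl// mulrCA; lra.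
have kn0 : (0 <= (kappa / (2 * n%:R))%:E)%E.
  by rewrite lee_fin divr_ge0 ?mulr_ge0 ?ltW.
have [mB _ _] := hB.
have mSB : measurable_fun setT (fun w => S (mxrows (B w))).
  exact: measurableT_comp mS (measurable_mxrows _ _ _ mB).
rewrite ge0_integralD//; last 3 first.
- by move=> w _; rewrite lee_fin mulr_ge0// ltW.
- by move=> w _; rewrite mule_ge0.
- exact: measurable_funeM.
rewrite integral_prob_cst ge0_integralZl//.
rewrite (integral_gaussian_matrix P n q B S)//.
have IG0 : (0 <= \int[P']_w G w * (Num.sqrt n%:R)^-1%:E)%E.
  by rewrite mule_ge0 ?integral_ge0// lee_fin invr_ge0.
have eps0 : (0 <= eps%:E)%E by rewrite lee_fin.
rewrite (ge0_muleDr _ IG0 eps0) addeC -EFinM; apply: leeD => //.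
have rows := @integral_ssup_rows R q cv cv0 n (fun=> 0) erefl.
apply: le_trans (lee_wpmul2l kn0 rows) _.
apply: (@le_trans _ _ ((kappa / (2 * n%:R))%:E *
    \int[power_prob gauss q]_g ((2 * Num.sqrt n%:R)%:E * W g))%E).
  apply: lee_wpmul2l => //; apply: ge0_le_integral => //.
  - move=> t _; apply: ssup_ge0.
    by rewrite /tdot big1 ?mulr0 ?addr0// => k _; rewrite cv0 mul0r.
  - apply: measurable_ssup => j; apply: measurable_funD => //.
    by apply: measurable_funM => //; exact: measurable_tdot.
  - exact: measurable_funeM.
  move=> t _; apply: ssup_le => j; rewrite add0r EFinM.
  by apply: lee_wpmul2l; [rewrite lee_fin mulr_ge0|exact: le_ssup].
have s0 : (0 <= (2 * Num.sqrt n%:R : R)%:E)%E by rewrite lee_fin mulr_ge0.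
rewrite ge0_integralZl//.
rewrite muleA -EFinM.
have -> : kappa / (2 * n%:R) * (2 * Num.sqrt n%:R) = kappa / Num.sqrt n%:R.
  have n2 : n%:R = Num.sqrt n%:R ^+ 2 :> R by rewrite sqr_sqrtr// ltW.
  have sn0 : 0 < Num.sqrt n%:R :> R by rewrite sqrtr_gt0.
  by rewrite {1}n2; field; rewrite gt_eqF.
rewrite EFinM -muleA (muleC _ (_^-1)%:E).
apply: lee_wpmul2l; first by rewrite lee_fin ltW.
apply: lee_wpmul2l; first by rewrite lee_fin invr_ge0.
(* Only the measurable [W] changes probability space; [G] enters afterwards by pointwise comparison
   on [T']. *)
rewrite -(integral_gaussian_vector P' q g W hg)//.
exact: le_lower_integral.
Qed.
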